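(* For every infinite cardinal $\lambda$ there is a Urysohn space $X$ in which every subset of size $\lambda$ is closed, hence $X$ is $\lambda$-monolithic, such that $(\kappa,\lambda)$ is a pinning down pair for $X$ for every cardinal $\kappa$ with $\lambda < \kappa < 2^{2^\lambda}$, but $d(X) = \lambda^+$.
   Context: For cardinals $\kappa > \lambda \ge \omega$, $(\kappa,\lambda)$ is a pinning down pair for a topological space $X$ if for every family $\mathcal{U}$ of non-empty open sets in $X$ with $|\mathcal{U}| \le \kappa$ there is $B \subset X$ with $|B| \le \lambda$ such that $B \cap U \ne \emptyset$ for each $U \in \mathcal{U}$. A space is Urysohn if any two distinct points have neighborhoods with disjoint closures. $X$ is $\lambda$-monolithic if $nw(\overline{Y}) \le \lambda$ for every $Y \subset X$ with $|Y| = \lambda$, where $nw$ denotes network weight. $d(X)$ is the density of $X$. *)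

(* Defs.v *)
From mathcomp Require Import all_boot.
From mathcomp Require Import all_classical topology.

Set Implicit Arguments.
Unset Strict Implicit.
Unset Printing Implicit Defensive.

Local Open Scope classical_set_scope.
Local Open Scope card_scope.

(* A cardinal is given by a type representing it: the cardinal of K is the
   cardinality of [set: K], and 2^(2^L) is represented by set (set L). *)

Definition infinite_card (L : Type) : Prop := infinite_set [set: L].

Definition card_lt (K L : Type) : Prop :=
  [set: K] #<= [set: L] /\ [set: K] #!= [set: L].

Definition successor_card (L S : Type) : Prop :=
  card_lt L S /\ forall M : Type, card_lt L M -> [set: S] #<= [set: M].

Definition pinning_down_pair (K L : Type) (X : topologicalType) : Prop :=
  [/\ infinite_card L,
      card_lt L K
    & forall U : set (set X),
        (forall V, U V -> open V /\ V !=set0) ->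
        U #<= [set: K] ->
        exists B : set X,
          B #<= [set: L] /\ (forall V, U V -> B `&` V !=set0)].

Definition urysohn_space (X : topologicalType) : Prop :=
  forall x y : X, x <> y ->
    exists U V : set X,
      [/\ nbhs x U, nbhs y V & closure U `&` closure V = set0].

Definition network (X : topologicalType) (N : set (set X)) : Prop :=
  forall (x : X) (U : set X), open U -> U x ->
    exists A : set X, [/\ N A, A x & A `<=` U].

(* nw(X) <= |L|, where nw(X) is the least cardinality of a network of X *)
Definition network_weight_le (X : topologicalType) (L : Type) : Prop :=
  exists N : set (set X), network N /\ N #<= [set: L].

(* set_type (closure Y) carries the subspace topology. *)
Definition monolithic (L : Type) (X : topologicalType) : Prop :=
  forall Y : set X, Y #= [set: L] ->
    network_weight_le (set_type (closure Y)) L.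

(* d(X) = |D|, where d(X) is the least cardinality of a dense subset of X *)
Definition density_eq (X : topologicalType) (D : Type) : Prop :=
  (exists A : set X, dense A /\ A #= [set: D]) /\
  (forall A : set X, dense A -> [set: D] #<= A).

(* Main.v *)
Require Import Defs.
From HB Require Import structures.
From mathcomp Require Import all_boot.
From mathcomp Require Import all_classical topology.

(* Refine the product topology of the Cantor cube 2^(2^L) by making every set
   of size at most L closed. Coordinates still separate points by clopen sets,
   so the space is Urysohn. The cube has a dense set B of size L and is a group
   of cardinality 2^(2^L): fewer than 2^(2^L) basic open sets, each with L
   points removed, are all met by a single translate of B, since only fewer than
   2^(2^L) translations can move a point of B onto a removed point. Finally the
   union of L^+ translates of B is dense, and no set of size L is. *)

Set Implicit Arguments.
Unset Strict Implicit.
Unset Printing Implicit Defensive.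

Local Open Scope classical_set_scope.
Local Open Scope card_scope.

(** * Cardinal arithmetic: comparability, squares, unions, lists *)

Lemma injective_card_le (T U : Type) (f : T -> U) :
  injective f -> [set: T] #<= [set: U].
Proof.
move=> fI; have [g] : $|{injfun [set: T] >-> [set: U]}|.
  by apply/injfunPex; exists f => // x y _ _; apply: fI.
exact: inj_card_le.
Qed.

Lemma card_le_injective (T U : Type) :
  [set: T] #<= [set: U] -> exists f : T -> U, injective f.
Proof.
elim/Ppointed: U => U; last by move=> /pcard_injP[f fI]; exists f; apply: in2TT.
rewrite emptyE => /eqP T0.
have h (x : T) : False by have : [set: T] x by []; rewrite T0.
by exists (fun x => False_rect U (h x)) => x; case: (h x).
Qed.

(* The maximal element below is a maximal family of points of the product all
   of whose projections are injective; were no projection onto, one more point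
   avoiding every projection could be added. *)
Lemma card_le_minimum (I : Type) (A : I -> Type) :
  inhabited I -> exists i, forall j, [set: A i] #<= [set: A j].
Proof.
move=> [i0].
pose P (F : set (forall i, A i)) :=
  forall i f g, F f -> F g -> f i = g i -> f = g.
have [F FP Ftot|F [PF maxF]] := @Zorn_bigcup _ P.
  move=> i f g [X FX Xf] [Y FY Yg].
  case: (Ftot _ _ FX FY) => [XY|YX].
    by apply: (FP _ FY) => //; apply: XY.
  by apply: (FP _ FX) => //; apply: YX.
have [i onto] : exists i, forall a, exists2 f, F f & f i = a.
  apply: contrapT => /forallNP nonto.
  have /all_sig[a aP] i : {a : A i | forall f, F f -> f i <> a}.
    apply: cid; have /existsNP[a na] := nonto i; exists a => f Ff fia.
    by apply: na; exists f.
  apply: (maxF (F `|` [set a])).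
    split; first by move=> f; left.
    by move=> /(_ a) /(_ (or_intror erefl)) Fa; exact: (aP i0 _ Fa).
  move=> i f g [Ff|->] [Fg|->] //; first exact: PF.
    by move=> /aP => /(_ Ff).
  by move=> /esym /aP => /(_ Fg).
exists i => j; have /choice[h hP] : forall a, exists f, F f /\ f i = a.
  by move=> a; have [f] := onto a; exists f.
apply: (@injective_card_le _ _ (fun a => h a j)) => a b hab.
have [Fa <-] := hP a; have [Fb <-] := hP b.
by rewrite (PF j _ _ Fa Fb hab).
Qed.

(** This is [card_le_minimum] for a family of two types indexed by [bool]. *)
Lemma card_le_total (T U : Type) (A : set T) (B : set U) :
  A #<= B \/ B #<= A.
Proof.
rewrite -(card_le_eql (card_setT A)) -(card_le_eqr (card_setT B)).
rewrite -(card_le_eql (card_setT B)) -(card_le_eqr (card_setT A)).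
have [] := @card_le_minimum bool
  (fun b => if b then set_type A else set_type B) (inhabits true).
by case=> /[dup] /(_ true) + /(_ false); [left | right].
Qed.

(* A maximal partial pairing, defined on A x A and with values in A, is
   identified with its graph. If A embeds into its complement, a disjoint copy
   of A can be adjoined to A; otherwise the whole type embeds into A x A. *)
Lemma infinite_card_prod (T : Type) :
  infinite_set [set: T] -> [set: T * T] #<= [set: T].
Proof.
elim/Ppointed: T => T; first by rewrite !emptyE.
move=> /infiniteP /card_le_injective[e eI].
pose dom (G : set (T * T * T)) u :=
  exists2 q, G q & [\/ u = q.1.1, u = q.1.2 | u = q.2].
pose good G := [/\ forall x y z z', G (x, y, z) -> G (x, y, z') -> z = z',
  forall x y x' y' z, G (x, y, z) -> G (x', y', z) -> x = x' /\ y = y' &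
  forall u v, dom G u -> dom G v -> exists z, G (u, v, z)].
(* The pairing [pickle] of natural numbers, transported to the copy of nat given by [e]. *)
pose G0 : set (T * T * T) :=
  range (fun mn : nat * nat => (e mn.1, e mn.2, e (pickle mn))).
have good0 : good G0.
  split.
  - by move=> x y z z' [[m n] _ [<- <- <-]] [[m' n'] _ [/eI-> /eI-> <-]].
  - move=> x y x' y' z [mn _ [<- <- <-]] [mn' _ [<- <- /eI]].
    by move=> /(pcan_inj pickleK) ->.
  - have dom0 u : dom G0 u -> exists n, u = e n.
      by case=> _ [mn _ <-] /= [] ->; eexists.
    move=> u v /dom0[m ->] /dom0[n ->]; exists (e (pickle (m, n))).
    by exists (m, n).
(* Adjoining [G0] keeps the union of the empty chain good and puts every [e n] in the domain of the
   maximal pairing. *)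
have [F FP Ftot|M [PM maxM]] := @Zorn_bigcup _ (fun G => good (G0 `|` G)).
  set U := _ `|` _.
  (* Each clause of [good] involves at most two triples of the union, so it can be checked in a
     single good [H]. *)
  have common p q : U p -> U q -> exists H, [/\ good H, H p, H q & H `<=` U].
    have in1 X r : F X -> (G0 `|` X) r -> U r.
      by move=> FX [?|Xr]; [left | right; exists X].
    case=> [G0p|[X FX Xp]] [G0q|[Y FY Yq]].
    - by exists G0; split => // r; left.
    - exists (G0 `|` Y); split; [exact: FP | by left | by right |].
      by move=> r; apply: in1.
    - exists (G0 `|` X); split; [exact: FP | by right | by left |].
      by move=> r; apply: in1.
    - have [XY|YX] := Ftot _ _ FX FY.
        exists (G0 `|` Y); split; [exact: FP | by right; apply: XY |
          by right |].
        by move=> r; apply: in1.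
      exists (G0 `|` X); split; [exact: FP | by right |
        by right; apply: YX |].
      by move=> r; apply: in1.
  split.
  - move=> x y z z' p q; have [H [[h _ _] Hp Hq _]] := common _ _ p q.
    exact: h Hp Hq.
  - move=> x y x' y' z p q; have [H [[_ h _] Hp Hq _]] := common _ _ p q.
    exact: h Hp Hq.
  - move=> u v [p Up up] [q Uq vq].
    have [H [[_ _ h] Hp Hq HU]] := common _ _ Up Uq.
    have [||z Hz] := h u v; [by exists p | by exists q |].
    by exists z; apply: HU.
set G := G0 `|` M in PM.
have [Gfun Ginj Gdom] := PM.
pose A := dom G.
have [p pG] : exists p : T -> T -> T,
    forall x y, A x -> A y -> G (x, y, p x y).
  exists (fun x y => xget point (fun z => G (x, y, z))) => x y Ax Ay.
  exact: (xgetPex _ (Gdom _ _ Ax Ay)).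
have pA x y : A x -> A y -> A (p x y).
  by move=> Ax Ay; exists (x, y, p x y); [exact: pG | constructor 3].
have pI x y x' y' : A x -> A y -> A x' -> A y' ->
    p x y = p x' y' -> x = x' /\ y = y'.
  move=> Ax Ay Ax' Ay' pe; apply: (Ginj _ _ _ _ (p x y)); first exact: pG.
  by rewrite pe; apply: pG.
have Ae n : A (e n).
  exists (e n, e n, e (pickle (n, n))); last by constructor.
  by left; exists (n, n).
have [|] := card_le_total A (~` A).
  move=> /pcard_leP/injfunPex[g gC gI'].
  have gI x y : A x -> A y -> g x = g y -> x = y.
    by move=> Ax Ay; apply: gI'; rewrite inE.
  (* [dec false] and [dec true] are the two disjoint copies of [A]; the new pairing [G'] lives on
     their union. *)
  pose dec (b : bool) a := if b then g a else a.
  have decI b c x y : A x -> A y -> dec b x = dec c y -> b = c /\ x = y.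
    move=> Ax Ay; case: b c => [] [] //=.
    - by move=> /gI->.
    - by move=> gxy; case: (gC x Ax); rewrite gxy.
    - by move=> gxy; case: (gC y Ay); rewrite -gxy.
  (* The tags eb b and eb c record in which of the two copies the arguments
     lie, so that the values at new pairs are distinct. *)
  pose eb (b : bool) := e b.
  pose val (b c : bool) x y :=
    if b || c then g (p (p (eb b) (eb c)) (p x y)) else p x y.
  have ebA b : A (eb b) by apply: Ae.
  have valI b c x y b' c' x' y' : A x -> A y -> A x' -> A y' ->
      val b c x y = val b' c' x' y' -> [/\ b = b', c = c', x = x' & y = y'].
    move=> Ax Ay Ax' Ay'; rewrite /val.
    case: ifPn => bc; case: ifPn => bc'.
    - have pp := pA _ _ (pA _ _ (ebA b) (ebA c)) (pA _ _ Ax Ay).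
      have pp' := pA _ _ (pA _ _ (ebA b') (ebA c')) (pA _ _ Ax' Ay').
      move=> /(gI _ _ pp pp').
      move=> /(pI _ _ _ _ (pA _ _ _ _) (pA _ _ _ _) (pA _ _ _ _) (pA _ _ _ _)).
      case=> // /(pI _ _ _ _ (ebA b) (ebA c) (ebA b') (ebA c'))[/eI + /eI].
      move=> + + /(pI _ _ _ _ Ax Ay Ax' Ay')[-> ->].
      by case: (b) (b') (c) (c') => [] [] [] [].
    - move=> gp; case: (gC (p (p (eb b) (eb c)) (p x y))).
        by apply: (pA _ _ (pA _ _ _ _) (pA _ _ _ _)).
      by rewrite gp; apply: pA.
    - move=> gp; case: (gC (p (p (eb b') (eb c')) (p x' y'))).
        by apply: (pA _ _ (pA _ _ _ _) (pA _ _ _ _)).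
      by rewrite -gp; apply: pA.
    - by move=> /pI[] // -> ->; move: bc bc'; case: b b' c c' => [] [] [] [].
  pose G' : set (T * T * T) := fun q => exists b c x y,
    [/\ A x, A y & q = (dec b x, dec c y, val b c x y)].
  have domG' u : dom G' u -> exists b x, A x /\ u = dec b x.
    case=> _ [b [c [x [y [Ax Ay ->]]]]] /= [] ->.
    - by exists b, x.
    - by exists c, y.
    - rewrite /val; case: ifP => _.
        exists true, (p (p (eb b) (eb c)) (p x y)); split=> //.
        by apply: (pA _ _ (pA _ _ _ _) (pA _ _ _ _)).
      by exists false, (p x y); split=> //; apply: pA.
  have goodG' : good G'.
    split.
    - move=> x y z z' [b [c [a [d [Aa Ad [-> -> ->]]]]]].
      move=> [b' [c' [a' [d' [Aa' Ad' [+ + ->]]]]]].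
      by move=> /decI[] // -> -> /decI[] // -> ->.
    - move=> x y x' y' z [b [c [a [d [Aa Ad [-> -> ->]]]]]].
      move=> [b' [c' [a' [d' [Aa' Ad' [-> ->]]]]]].
      by move=> /valI[] // -> -> -> ->.
    - move=> u v /domG'[b [x [Ax ->]]] /domG'[c [y [Ay ->]]].
      by exists (val b c x y), b, c, x, y.
  have GG' : G `<=` G'.
    move=> [[x y] z] Gq; exists false, false, x, y; rewrite /val /=.
    have Ax : A x by exists (x, y, z) => //; constructor 1.
    have Ay : A y by exists (x, y, z) => //; constructor 2.
    by split=> //; rewrite (Gfun _ _ _ _ Gq (pG _ _ Ax Ay)).
  case: (maxM G').
    split; first by move=> q Mq; apply: GG'; right.
    (* [G'] is a proper extension, since its domain contains [g (e 0)], which is outside [A]. *)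
    move=> G'M; apply: (gC (e 0) (Ae 0)).
    have : G (g (e 0), g (e 0), val true true (e 0) (e 0)).
      right; apply: G'M; exists true, true, (e 0), (e 0).
      by split.
    by move=> Gq; eexists; [exact: Gq | constructor].
  suff -> : G0 `|` G' = G' by [].
  by apply/setUidPr => q G0q; apply: GG'; left.
move=> /pcard_leP/injfunPex[h hA hI'].
have hI x y : ~ A x -> ~ A y -> h x = h y -> x = y.
  by move=> Ax Ay; apply: hI'; rewrite inE.
(* The tags [e 0] and [e 1] separate [A] from its complement, so all of [T] embeds into [A], where
   [p] is a pairing. *)
pose k x := if `[<A x>] then p (e 0) x else p (e 1) (h x).
have kA x : A (k x) by rewrite /k; case: asboolP => ?; apply: pA => //; exact: hA.
have kI : injective k.
  move=> x y; rewrite /k; case: asboolP => Ax; case: asboolP => Ay.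
  - by move=> /pI[].
  - by move=> /pI[] //; [exact: hA | move=> /eI].
  - by move=> /pI[] //; [exact: hA | move=> /eI].
  - by move=> /pI[] //; [exact: hA | exact: hA | move=> _; apply: hI].
apply: (@injective_card_le _ _ (fun xy => p (k xy.1) (k xy.2))).
by move=> [x y] [x' y'] /= /pI[] // /kI -> /kI ->.
Qed.

(** Choose for each point a member of the family containing it, and pair the code of its index with
    the code of the point inside that member. *)
Lemma card_le_bigcup (I T K : Type) (D : set I) (F : I -> set T) :
  infinite_set [set: K] -> D #<= [set: K] ->
  (forall i, D i -> F i #<= [set: K]) -> \bigcup_(i in D) F i #<= [set: K].
Proof.
elim/Ppointed: I => I in D F *.
  by rewrite (empty_eq0 D) bigcup_set0 => *; apply: card_ge0.
elim/Ppointed: K => K; first by rewrite !emptyE.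
move=> /infinite_card_prod/card_le_injective[p pI] /pcard_injP[d dI] FK.
have /choice[h hI] : forall i, exists h : T -> K, D i -> {in F i &, injective h}.
  move=> i; have [/FK/pcard_injP[h hI]|nDi] := pselect (D i); first by exists h.
  by exists (fun=> point).
have /choice[k kP] : forall x, exists i, (\bigcup_(i in D) F i) x -> D i /\ F i x.
  move=> x; have [[i Di Fx]|nx] := pselect ((\bigcup_(i in D) F i) x).
    by exists i.
  by exists point.
apply/pcard_injP; exists (fun x => p (d (k x), h (k x) x)) => x y.
rewrite !inE => /kP[Dx Fx] /kP[Dy Fy] /pI[/dI kxy].
rewrite kxy ?inE // in Fx *; by apply: hI; rewrite ?inE.
Qed.

Lemma card_le_setU (T K : Type) (A B : set T) :
  infinite_set [set: K] -> A #<= [set: K] -> B #<= [set: K] ->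
  A `|` B #<= [set: K].
Proof.
move=> Kinf AK BK; rewrite (_ : A `|` B = \bigcup_b (if b then A else B)).
  apply: card_le_bigcup => //; last by case.
  have /infiniteP := Kinf; apply: card_le_trans; exact: countableP.
apply/seteqP; split => [x [Ax|Bx]|x [[] _]].
- by exists true.
- by exists false.
- by left.
- by right.
Qed.

(** Lists are folded by iterated pairing; the length is stored too, because the folded code alone
    does not tell where the list ends. *)
Lemma infinite_card_seq (T : Type) :
  infinite_set [set: T] -> [set: seq T] #<= [set: T].
Proof.
move=> Tinf; have /infiniteP/card_le_injective[e eI] := Tinf.
have /card_le_injective[p pI] := infinite_card_prod Tinf.
pose code := foldr (fun x c => p (x, c)) (e 0).
apply: (@injective_card_le _ _ (fun s => p (e (size s), code s))) => s t.
move=> /pI[/eI]; elim: s t => [|x s IHs] [|y t] //= [st] /pI[-> ct].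
by rewrite (IHs t).
Qed.

(** * Cantor's theorem and successor cardinals *)

Lemma card_lt_set (T : Type) : card_lt T (set T).
Proof.
split.
  apply: (@injective_card_le _ _ set1) => x y xy.
  by have : [set y] x by rewrite -xy.
apply/negP => /card_eqPle[_ /card_le_injective[f fI]].
(* The diagonal set for an injection [f]: whether [f D] lies in [D] is contradictory either way. *)
pose D : set T := fun x => exists2 A, f A = x & ~ A x.
have DfD : ~ D (f D) by move=> /[dup] -[A /fI->].
by apply: (DfD); exists D.
Qed.

Lemma card_lt_leN (T U V : Type) (A : set V) :
  A #= [set: U] -> card_lt T U -> ~ (A #<= [set: T]).
Proof.
move=> AU [TU]; rewrite (card_le_eql AU) => /negP TnU UT.
exact/TnU/Cantor_Bernstein.
Qed.

Lemma card_ltP (T U : Type) :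
  card_lt T U <-> ~ ([set: U] #<= [set: T]).
Proof.
split=> [|nUT]; first exact: card_lt_leN.
split; first by have [] := card_le_total [set: T] [set: U].
by apply/negP => /card_eqPle[].
Qed.

(** The minimum is taken over the subsets of [set T] that do not embed into [T]. This suffices: any
    [M] is either at least as large as [set T] or equinumerous to such a subset. *)
Lemma successor_card_exists (T : Type) :
  exists S : Type, successor_card T S /\ [set: S] #<= [set: set T].
Proof.
pose I := {A : set (set T) | ~ (A #<= [set: T])}.
pose mkI A h : I := exist _ A h.
have iT : ~ ([set: set T] #<= [set: T]) by apply/card_ltP/card_lt_set.
have [[S nS] Smin] := @card_le_minimum I (fun A => set_type (sval A))
  (inhabits (mkI _ iT)).
exists (set_type S); split; last by rewrite (card_le_eql (card_setT S)) card_leT.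
split; first by apply/card_ltP; rewrite (card_le_eql (card_setT S)).
move=> M /card_ltP TM.
have [TM'|] := card_le_total [set: set T] [set: M].
  apply: card_le_trans TM'.
  apply: card_le_trans (Smin (mkI _ iT)) _.
  by rewrite (card_le_eql (card_setT _)).
move=> /card_subP[C CM _].
have nC : ~ (C #<= [set: T]) by rewrite (card_le_eql CM).
apply: card_le_trans (Smin (mkI _ nC)) _.
rewrite (card_le_eql (card_setT C)).
by have /card_eqPle[] := CM.
Qed.

(** * The Cantor cube and its small dense subset *)

Definition cylinder (I : eqType) (s : seq I) (x : I -> bool) : set (I -> bool) :=
  [set y : I -> bool | {in s, y =1 x}].

(** The group operation of the cube; every element is its own inverse. *)
Definition xor (I : Type) (x y : I -> bool) : I -> bool := fun i => x i (+) y i.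

Lemma xorK (I : Type) (p : I -> bool) : involutive (xor p).
Proof. by move=> x; apply/funext => i; rewrite /xor addbA addbb. Qed.

(* Hewitt-Marczewski-Pondiczery for 2^(2^L): finitely many distinct subsets of
   L have distinct traces on some finite list w of elements of L, so the points
   S |-> (trace of S on w is in C), for w and C finite, are dense. *)
Lemma cantor_cube_dense (L : Type) : infinite_set [set: L] ->
  exists2 B : set (set L -> bool), B #<= [set: L] &
    forall s x, exists2 b, B b & cylinder s x b.
Proof.
elim/Pchoice: L => L Linf.
pose trace (w : seq L) (S : set L) := [seq `[<S l>] | l <- w].
pose pt (wc : seq L * seq (seq bool)) (S : set L) := trace wc.1 S \in wc.2.
exists (range pt).
  apply: card_le_trans (card_image_le _ _) _.
  have /infiniteP Lnat := Linf.
  have /card_le_injective[p pI] := infinite_card_prod Linf.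
  have /card_le_injective[f fI] := infinite_card_seq Linf.
  have /card_le_injective[g gI] : [set: seq (seq bool)] #<= [set: L].
    by apply: card_le_trans Lnat; exact: countableP.
  apply: (@injective_card_le _ _ (fun wc => p (f wc.1, g wc.2))).
  by move=> [w c] [w' c'] /= /pI[/fI-> /gI->].
move=> s x.
have [l0] : [set: L] !=set0 by apply: infinite_setN0.
move=> _; have /choice[d dP] : forall ST : set L * set L, exists l,
    ST.1 <> ST.2 -> `[<ST.1 l>] <> `[<ST.2 l>].
  move=> [S S'] /=; have [->|SS'] := pselect (S = S'); first by exists l0.
  have [l nl] : exists l, S l <> S' l.
    by apply/existsNP => h; apply: SS'; apply/funext.
  by exists l => _ SlS; apply: nl; apply: propext; exact: asbool_eq_equiv.
(* One separating element for each pair of members of [s], so that distinct members have distinct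
   traces on [w]. *)
pose w := [seq d (R, R') | R <- s, R' <- s].
have traceI S S' : S \in s -> S' \in s -> trace w S = trace w S' -> S = S'.
  move=> Ss S's /eq_in_map trE; apply: contrapT => /(dP (S, S')) /=; apply.
  by apply: trE; apply: allpairs_f.
exists (pt (w, [seq trace w R | R <- s & x R])); first by eexists.
move=> S Ss; rewrite /pt /=; apply/mapP/idP => [[S']|xS].
  rewrite mem_filter => /andP[xS' S's] /traceI -> //.
by exists S => //; rewrite mem_filter xS.
Qed.

(** * The refined topology and its separation properties *)

Definition cocard_cube (L : Type) & infinite_card L := set L -> bool.

Section cocard_cube.
Context (L : Type) (hL : infinite_card L).
Local Notation X := (cocard_cube hL).

HB.instance Definition _ := gen_eqMixin X.
HB.instance Definition _ := gen_choiceMixin X.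

Definition cocard_open : set (set X) := fun O => forall x, O x ->
  exists s (A : set X), A #<= [set: L] /\ cylinder s x `\` A `<=` O.

Let cocard_openT : cocard_open setT.
Proof. by move=> x _; exists [::], set0; split => //; apply: card_ge0. Qed.

(** The union of two removed sets stays small because [L] is infinite; this is why the type
    [cocard_cube] carries [hL]. *)
Let cocard_openI : setI_closed cocard_open.
Proof.
move=> O O' Oop O'op x [/Oop[s [A [AL AO]]] /O'op[s' [A' [A'L AO']]]].
exists (s ++ s'), (A `|` A'); split; first exact: card_le_setU.
move=> y [ys /not_orP[yA yA']]; split.
  by apply: AO; split=> // S Ss; apply: ys; rewrite mem_cat Ss.
by apply: AO'; split=> // S Ss; apply: ys; rewrite mem_cat Ss orbT.
Qed.

Let cocard_open_bigU (I : Type) (f : I -> set X) :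
  (forall i, cocard_open (f i)) -> cocard_open (\bigcup_i f i).
Proof.
move=> fop x [i _ /fop[s [A [AL Af]]]]; exists s, A; split => // y /Af fy.
by exists i.
Qed.

HB.instance Definition _ :=
  isOpenTopological.Build X cocard_openT cocard_openI cocard_open_bigU.

Lemma cocard_cube_openE : @open X = cocard_open.
Proof. by []. Qed.

Lemma small_closed (Y : set X) : Y #<= [set: L] -> closed Y.
Proof.
move=> YL; rewrite -openC cocard_cube_openE => x nYx.
by exists [::], Y; split=> // y [].
Qed.

Lemma coordinate_clopen (S : set L) (b : bool) : clopen [set x : X | x S = b].
Proof.
have op c : open [set x : X | x S = c].
  rewrite cocard_cube_openE => x /= xS; exists [:: S], set0.
  split; first exact: card_ge0.
  by move=> y [/(_ S) /= -> //]; rewrite inE.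
split=> //; rewrite -openC (_ : ~` _ = [set x : X | x S = ~~ b]) //.
by apply/seteqP; split=> x /=; case: (x S) b => [] [].
Qed.

Lemma cocard_cube_urysohn : urysohn_space X.
Proof.
move=> x y xy; have [S xyS] : exists S, x S <> y S.
  by apply/existsNP => h; apply: xy; apply/funext.
have clop b := coordinate_clopen S b.
exists [set z : X | z S = x S], [set z : X | z S = y S].
split.
- by apply: open_nbhs_nbhs; split=> //; have [] := clop (x S).
- by apply: open_nbhs_nbhs; split=> //; have [] := clop (y S).
- have [_ /closure_id <-] := clop (x S); have [_ /closure_id <-] := clop (y S).
  by apply/seteqP; split=> // z /= [->].
Qed.

(** [Y] is its own closure, so the singletons of its points form a small enough network. *)
Lemma cocard_cube_monolithic : monolithic L X.
Proof.
move=> Y YL; exists (range set1); split.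
  by move=> y U _ Uy; exists [set y]; split=> // _ ->.
apply: card_le_trans (card_image_le _ _) _; rewrite (card_le_eql (card_setT _)).
have /card_eqPle[YleL _] := YL.
by have /closure_id <- := small_closed YleL.
Qed.

(** * Size of the cube, pinning down and density *)

Lemma card_cube : [set: set (set L)] #<= [set: X].
Proof.
apply: (@injective_card_le _ X (fun A S => `[<A S>])) => A B AB.
apply/funext => S; apply: propext; apply: asbool_eq_equiv.
exact: (congr1 (fun x : X => x S) AB).
Qed.

Lemma card_le_xor (p : X) (T : Type) (A : set X) :
  A #<= [set: T] -> (@xor _ p @` A) #<= [set: T].
Proof. exact/card_le_trans/card_image_le. Qed.

Lemma cocard_cube_pinning_down (K : Type) :
  card_lt L K -> card_lt K (set (set L)) -> pinning_down_pair K L X.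
Proof.
move=> LK KL; split=> // U Uop UK.
have Kinf : infinite_set [set: K].
  by apply/infiniteP; apply: card_le_trans LK.1; apply/infiniteP.
have LleK := LK.1.
have [B BL Bdense] := cantor_cube_dense hL.
have /choice[h hP] : forall V, exists xsA : X * seq (set L) * set X, U V ->
    xsA.2 #<= [set: L] /\ cylinder xsA.1.2 xsA.1.1 `\` xsA.2 `<=` V.
  move=> V; have [|nUV] := pselect (U V); last by exists (fun=> true, [::], set0).
  move=> /Uop[]; rewrite cocard_cube_openE => Vop [x /Vop[s [A AV]]].
  by exists (x, s, A).
(* The translations that move some point of [B] onto a point removed from some chosen basic open
   set. *)
pose bad := \bigcup_(b in B) (@xor _ b @` \bigcup_(V in U) (h V).2).
have badK : bad #<= [set: K].
  apply: card_le_bigcup => // [|b Bb]; first exact: card_le_trans LleK.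
  apply: card_le_xor; apply: card_le_bigcup => // V /hP[AL _].
  exact: card_le_trans LleK.
have [p nbad] : exists p, ~ bad p.
  apply/existsNP => allbad; have /card_ltP := KL; apply.
  apply: card_le_trans card_cube _; apply: card_le_trans badK.
  exact: subset_card_le.
exists (@xor _ p @` B); split; first exact: card_le_xor.
move=> V UV; have [AL AV] := hP V UV.
(* Since [b] agrees with [xor p x] on the coordinates in [s], its translate [xor p b] agrees there
   with the centre [x] of the basic set chosen in [V]. *)
have [b Bb bs] := Bdense (h V).1.2 (xor p (h V).1.1).
exists (xor p b); split; first by exists b.
apply: AV; split=> [S Ss|Apb].
  by rewrite /xor bs // /xor addbA addbb.
apply: nbad; exists b => //; exists (xor p b); first by exists V.
by apply/funext => S; rewrite /xor addbC -addbA addbb addbF.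
Qed.

(** A small dense set would be closed, hence the whole space, which has more than |L| points. *)
Lemma dense_not_small (D : set X) : dense D -> ~ (D #<= [set: L]).
Proof.
move=> Dd DL; have Dcl := small_closed DL.
have LX : ~ ([set: X] #<= [set: L]).
  move=> XL; have /card_ltP := card_lt_set L; apply.
  apply: card_le_trans (card_lt_set (set L)).1 _.
  exact: card_le_trans card_cube _.
apply: LX; apply: card_le_trans DL; apply: subset_card_le => x _.
apply: contrapT => nDx; rewrite -openC in Dcl.
by have [y []] := Dd _ (ex_intro _ x nDx) Dcl.
Qed.

(* The union of translates of a dense set of size at most L by successor-many
   points meets every open set in more than L points. *)
Lemma cocard_cube_density (S : Type) :
  successor_card L S -> [set: S] #<= [set: set L] -> density_eq X S.
Proof.
move=> [LS Smin] SL.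
have dense_ge (D : set X) : dense D -> [set: S] #<= D.
  move=> /dense_not_small nDL; rewrite -(card_le_eqr (card_setT D)).
  by apply: Smin; apply/card_ltP; rewrite (card_le_eql (card_setT D)).
split=> //.
have Sinf : infinite_set [set: S].
  by apply/infiniteP; apply: card_le_trans LS.1; apply/infiniteP.
have [B BL Bdense] := cantor_cube_dense hL.
have /card_subP[P PS _] : [set: S] #<= [set: X].
  apply: card_le_trans SL _; apply: card_le_trans (card_lt_set (set L)).1 _.
  exact: card_cube.
pose D : set X := \bigcup_(b in B) (@xor _ b @` P).
suff Dd : dense D.
  exists D; split=> //; apply: Cantor_Bernstein (dense_ge _ Dd).
  apply: card_le_bigcup => // [|b Bb]; first exact: card_le_trans LS.1.
  by apply: card_le_xor; have /card_eqPle[] := PS.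
move=> O [x Ox]; rewrite cocard_cube_openE => /(_ x Ox)[s [A [AL AO]]].
apply: contrapT => OD.
(* For each [p] in [P] some [b] in [B] puts [xor b p] into the cylinder around [x]. As [D] misses
   [O], that point lies in [A], so at most |L| translates of [A] cover [P], contradicting |P| =
   |S|. *)
have PL : P #<= [set: L].
  apply: (@card_le_trans _ _ _ (\bigcup_(b in B) (@xor _ b @` A))); last first.
    by apply: card_le_bigcup => // b Bb; apply: card_le_xor.
  apply: subset_card_le => p Pp.
  have [b Bb bs] := Bdense s (xor p x).
  exists b => //; exists (xor b p); last by rewrite xorK.
  apply: contrapT => nA; apply: OD; exists (xor b p); split.
    apply: AO; split=> // S' S's.
    by rewrite /xor bs // /xor addbC addbA addbb.
  by exists b => //; exists p.
exact: card_lt_leN PS LS PL.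
Qed.

End cocard_cube.

Theorem mainTheorem7 (L : Type) (hL : infinite_card L) :
  exists X : topologicalType,
    [/\ urysohn_space X,
        (forall Y : set X, Y #= [set: L] -> closed Y),
        monolithic L X,
        (forall K : Type, card_lt L K -> card_lt K (set (set L)) ->
           pinning_down_pair K L X)
      & exists S : Type, successor_card L S /\ density_eq X S].
Proof.
exists (cocard_cube hL); split.
- exact: cocard_cube_urysohn.
- by move=> Y /card_eqPle[YL _]; exact: small_closed YL.
- exact: cocard_cube_monolithic.
- by move=> K; apply: cocard_cube_pinning_down.
- have [S [LS SL]] := successor_card_exists L.
  by exists S; split=> //; apply: cocard_cube_density.
Qed.
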